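(* Let $K_{2n,2m}$ be the complete bipartite graph on $2n$ and $2m$ vertices, with $n,m\in\mathbb{N}$ (positive integers). Then $K_{2n,2m}$ admits an adapted complex structure.
   Context: For a finite simple graph $\mathcal{G}=(V,E)$ label $V=\{v_1,\dots,v_N\}$ and write $e_{i,j}$ ($i<j$) for the edge joining $v_i$ and $v_j$, if it exists. The Lie algebra $\mathfrak{n}_{\mathcal{G}}$ is the real vector space with basis $V\cup E$ and Lie bracket $[v_i,v_j]=e_{i,j}$ for $i<j$ if $v_i,v_j$ are adjacent, $[v_i,v_j]=0$ if they are not adjacent, and all elements of $E$ central. A complex structure on a real Lie algebra $\mathfrak{g}$ is a linear map $J:\mathfrak{g}\to\mathfrak{g}$ with $J^2=-\mathrm{Id}$ and $[x,y]+J([Jx,y]+[x,Jy])-[Jx,Jy]=0$ for all $x,y\in\mathfrak{g}$. The graph $\mathcal{G}$ admits an adapted complex structure if there is a complex structure $J$ on $\mathfrak{n}_{\mathcal{G}}$ such that for every $x\in V\cup E$ either $Jx\in V\cup E$ or $-Jx\in V\cup E$. *)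

(* Defs.v *)
From HB Require Import structures.
From mathcomp Require Import all_boot all_order all_algebra.
From mathcomp Require Import reals.

Set Implicit Arguments.
Unset Strict Implicit.
Unset Printing Implicit Defensive.

Import Order.TTheory GRing.Theory Num.Theory.
Local Open Scope ring_scope.

HB.mixin Record Lmodule_isLie (R : comNzRingType) V of GRing.Lmodule R V := {
  lie : V -> V -> V;
  lie_linearl : forall y, linear (lie^~ y);
  lie_linearr : forall x, linear (lie x);
  liexx : forall x, lie x x = 0;
  lie_jacobi : forall x y z,
    lie x (lie y z) + lie y (lie z x) + lie z (lie x y) = 0
}.

#[short(type="lieAlgType")]
HB.structure Definition LieAlgebra (R : comNzRingType) :=
  { V of GRing.Lmodule R V & Lmodule_isLie R V }.

Definition complex_structure (R : realType) (g : lieAlgType R)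
    (J : {linear g -> g}) : Prop :=
  (forall x : g, J (J x) = - x) /\
  (forall x y : g,
     lie x y + J (lie (J x) y + lie x (J y)) - lie (J x) (J y) = 0).

Record sgraph := SGraph {
  vertex :> finType;
  adj : rel vertex;
  adj_sym : symmetric adj;
  adj_irr : irreflexive adj
}.

(* The labelling v_1, ..., v_N of the vertices is the one given by enum_rank;
   the edge e_{i,j} is the pair (v_i, v_j) with i < j. *)
Definition is_edge (G : sgraph) (p : G * G) : bool :=
  (enum_rank p.1 < enum_rank p.2)%N && adj p.1 p.2.

Definition edge (G : sgraph) : finType := {p : G * G | is_edge p}.

Definition nbasis (G : sgraph) : finType := (vertex G + edge G)%type.

(* A vector is encoded by its coordinates in the basis nbasis G. *)
Definition nlie (R : realType) (G : sgraph) : Type := {ffun nbasis G -> R^o}.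

HB.instance Definition _ (R : realType) (G : sgraph) :=
  GRing.Lmodule.copy (nlie R G) {ffun nbasis G -> R^o}.

Section GraphLie.
Variables (R : realType) (G : sgraph).
Implicit Types (x y z : nlie R G) (a b : nbasis G) (u v : G).

Definition bvec a : nlie R G := [ffun b => (b == a)%:R].

(* e_{u,v} if it is an edge with u before v, and 0 otherwise *)
Definition evec u v : nlie R G :=
  if insub (u, v) is Some e then bvec (inr e) else 0.

(* [u, v] is e_{u,v} if u comes before v and -e_{v,u} otherwise: at most one of
   the two terms is nonzero. *)
Definition blie a b : nlie R G :=
  match a, b with
  | inl u, inl v => evec u v - evec v u
  | _, _ => 0
  end.

Definition nbracket x y : nlie R G :=
  \sum_(a : nbasis G) \sum_(b : nbasis G) (x a * y b) *: blie a b.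

Lemma nbracket_linearl y : linear (nbracket^~ y).
Proof.
move=> c x z; rewrite /nbracket scaler_sumr -big_split; apply: eq_bigr => a _ /=.
rewrite scaler_sumr -big_split; apply: eq_bigr => b _ /=.
by rewrite !ffunE mulrDl scalerDl -mulrA scalerA.
Qed.

Lemma nbracket_linearr x : linear (nbracket x).
Proof.
move=> c y z; rewrite /nbracket scaler_sumr -big_split; apply: eq_bigr => a _ /=.
rewrite scaler_sumr -big_split; apply: eq_bigr => b _ /=.
by rewrite !ffunE mulrDr scalerDl mulrCA scalerA.
Qed.

Lemma blieC a b : blie a b = - blie b a.
Proof. by case: a b => [u|e] [v|f] /=; rewrite ?oppr0 ?opprB. Qed.

Lemma nbracketxx x : nbracket x x = 0.
Proof.
have xxN : nbracket x x = - nbracket x x.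
  rewrite {1}/nbracket exchange_big /nbracket -sumrN; apply: eq_bigr => a _ /=.
  by rewrite -sumrN; apply: eq_bigr => b _; rewrite blieC scalerN mulrC.
apply/ffunP => a; apply/eqP; have /ffunP/(_ a)/eqP := xxN.
by rewrite [X in _ == X]ffunE -addr_eq0 -mulr2n mulrn_eq0 /= ffunE.
Qed.

Lemma nbracket_vertex x y v : nbracket x y (inl v) = 0.
Proof.
have ev u w : evec u w (inl v) = 0.
  by rewrite /evec; case: insub => [e|]; rewrite ffunE.
rewrite /nbracket sum_ffunE big1 // => a _; rewrite sum_ffunE big1 // => b _.
rewrite ffunE; case: a b => [u|e] [w|f] /=; rewrite !ffunE ?ev ?subrr ?scaler0 //.
Qed.

Lemma nbracket_step2 x y z : nbracket x (nbracket y z) = 0.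
Proof.
rewrite {1}/nbracket big1 // => a _; rewrite big1 // => -[v|f] _.
  by rewrite nbracket_vertex mulr0 scale0r.
by case: a => [u|e] /=; rewrite scaler0.
Qed.

Lemma nbracket_jacobi x y z :
  nbracket x (nbracket y z) + nbracket y (nbracket z x)
    + nbracket z (nbracket x y) = 0.
Proof. by rewrite !nbracket_step2 !addr0. Qed.

HB.instance Definition _ := Lmodule_isLie.Build R (nlie R G)
  nbracket_linearl nbracket_linearr nbracketxx nbracket_jacobi.

End GraphLie.

Definition is_bvec (R : realType) (G : sgraph) (x : nlie R G) : Prop :=
  exists b : nbasis G, x = bvec R b.

Definition admits_adapted_complex_structure (R : realType) (G : sgraph) : Prop :=
  exists J : {linear nlie R G -> nlie R G},
    complex_structure J /\
    forall a : nbasis G, is_bvec (J (bvec R a)) \/ is_bvec (- J (bvec R a)).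

Section CompleteBipartite.
Variables p q : nat.

Definition cbip_adj (u v : 'I_p + 'I_q) : bool :=
  match u, v with
  | inl _, inr _ | inr _, inl _ => true
  | _, _ => false
  end.

Lemma cbip_adj_sym : symmetric cbip_adj.
Proof. by case=> [i|i] [j|j]. Qed.

Lemma cbip_adj_irr : irreflexive cbip_adj.
Proof. by case. Qed.

Definition complete_bipartite : sgraph := SGraph cbip_adj_sym cbip_adj_irr.

End CompleteBipartite.

(* Main.v *)
Require Import Defs.
From HB Require Import structures.
From mathcomp Require Import all_boot all_order all_algebra.
From mathcomp Require Import reals.
From mathcomp Require Import zify ring.

(** Write a_i and b_j for the vertices of the two parts. J rotates the pairs
    (a_2k, a_2k+1) and (b_2l, b_2l+1) by a quarter turn, and acts on the edge
    e_ij = [a_i, b_j] through its first endpoint, so that J [x, y] = [J x, y]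
    for x in the span of the a_i and y in the span of the b_j. Then
    [x, y] + J [J x, y] = 0 and J [x, J y] = [J x, J y], which is
    integrability. *)

Set Implicit Arguments.
Unset Strict Implicit.
Unset Printing Implicit Defensive.

Import GRing.Theory.
Local Open Scope ring_scope.

Section Bracket.
Variables (R : realType) (G : sgraph).

Lemma evec_edgeE (u v : G) (e : edge G) :
  evec R u v (inr e) = (val e == (u, v))%:R.
Proof.
rewrite /evec; case: insubP => [f _ fE | nuv]; rewrite !ffunE.
  by rewrite -fE (inj_eq val_inj) /eq_op /= /eq_op.
by case: eqP => // eE; rewrite -eE (valP e) in nuv.
Qed.

(** In the double sum only the two orderings of the endpoints of [e] contribute. Together with
    [nbracket_vertex], this reduces integrability to an identity between coordinates. *)
Lemma nbracket_edgeE (x y : nlie R G) (e : edge G) :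
  nbracket x y (inr e) =
    x (inl (val e).1) * y (inl (val e).2)
    - x (inl (val e).2) * y (inl (val e).1).
Proof.
set u := (val e).1; set v := (val e).2.
have eE : val e = (u, v) by rewrite /u /v; case: (val e).
have uv : u != v.
  by apply/eqP => uv; have := valP e; rewrite eE /is_edge uv adj_irr andbF.
have blieE a b : blie R a b (inr e) =
    ((a == inl u) && (b == inl v))%:R - ((a == inl v) && (b == inl u))%:R.
  case: a b => [w|f] [w'|f'] /=; rewrite !ffunE ?andbF ?subrr //.
  rewrite !evec_edgeE eE !xpair_eqE !(inj_eq inl_inj).
  by rewrite ![_ == u]eq_sym ![_ == v]eq_sym [(u == w') && _]andbC.
rewrite /nbracket sum_ffunE.
under eq_bigr => a _.
  rewrite sum_ffunE.
  under eq_bigr => b _ do rewrite ffunE blieE /GRing.scale /= mulrBr.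
  rewrite big_split /= sumrN.
  over.
have sum_pair (c d : nbasis G) :
    \sum_a \sum_b x a * y b * ((a == c) && (b == d))%:R = x c * y d.
  rewrite (bigD1 c) //= (bigD1 d) //= !eqxx mulr1 big1 ?addr0 => [|b /negPf->].
    by rewrite big1 ?addr0 // => a /negPf ac; rewrite big1 // => b _;
      rewrite ac mulr0.
  by rewrite andbF mulr0.
by rewrite big_split /= sumrN !sum_pair.
Qed.

End Bracket.

Section FirstEndpointRotation.
(** [s] pairs up the vertices, and [eps] singles out the member of each pair whose image gets a
    minus sign. Since [is_edge] includes the order of the endpoints, [edge_s] also asks that the
    partner of a first endpoint still come first. *)
Variables (R : realType) (G : sgraph) (s : G -> G) (eps : G -> bool).
Hypothesis sK : involutive s.
Hypothesis eps_s : forall u, eps (s u) = ~~ eps u.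
Hypothesis edge_s : forall u v, is_edge (u, v) -> is_edge (s u, v).

(** The default value [e] is never taken, because [edge_s] makes the new pair an edge. *)
Definition edge_swap (e : edge G) : edge G :=
  insubd e (s (val e).1, (val e).2).

Lemma val_edge_swap (e : edge G) :
  val (edge_swap e) = (s (val e).1, (val e).2).
Proof.
rewrite val_insubd; case: ifP => // /negP[]; apply: edge_s.
by rewrite -surjective_pairing (valP e).
Qed.

Definition basis_swap (a : nbasis G) : nbasis G :=
  match a with inl u => inl (s u) | inr e => inr (edge_swap e) end.

Definition basis_sign (a : nbasis G) : bool :=
  match a with inl u => eps u | inr e => eps (val e).1 end.

Lemma basis_swapK : involutive basis_swap.
Proof.
case=> [u|e] /=; congr (_ _); first exact: sK.
by apply: val_inj; rewrite !val_edge_swap sK -surjective_pairing.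
Qed.

Lemma basis_sign_swap a : basis_sign (basis_swap a) = ~~ basis_sign a.
Proof. by case: a => [u|e] /=; rewrite ?val_edge_swap eps_s. Qed.

(** Coordinate [a] of the image comes from the basis vector [basis_swap a], whose sign is opposite
    to that of [a]; hence the negation in the exponent. *)
Definition rotation (x : nlie R G) : nlie R G :=
  [ffun a => (-1) ^+ (~~ basis_sign a) * x (basis_swap a)].

Lemma rotation_is_linear : linear rotation.
Proof.
move=> c x y; apply/ffunP => a; rewrite !ffunE /GRing.scale /= mulrDr.
by rewrite mulrCA.
Qed.

HB.instance Definition _ :=
  GRing.isLinear.Build R (nlie R G) (nlie R G) *:%R rotation
    rotation_is_linear.

Lemma rotationK (x : nlie R G) : rotation (rotation x) = - x.
Proof.
apply/ffunP => a; rewrite !ffunE basis_swapK basis_sign_swap.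
by case: (basis_sign a); rewrite /= ?expr0 ?expr1 ?mul1r ?mulN1r.
Qed.

Lemma rotation_bvec a :
  rotation (bvec R a) = (-1) ^+ (basis_sign a) *: bvec R (basis_swap a).
Proof.
apply/ffunP => b; rewrite !ffunE /GRing.scale /=.
rewrite (can2_eq basis_swapK basis_swapK).
by case: eqP => [->|_]; rewrite ?mulr0 // basis_sign_swap negbK.
Qed.

(** At an edge (u, v), rotating a bracket amounts to rotating the factor evaluated at u. As J^2 =
    -Id, the rotated sum is then [Jx, Jy] - [x, y]. *)
Lemma rotation_integrable (x y : nlie R G) :
  nbracket x y
  + rotation (nbracket (rotation x) y + nbracket x (rotation y))
  - nbracket (rotation x) (rotation y) = 0.
Proof.
apply/ffunP => -[v|e].
  by rewrite !ffunE !nbracket_vertex addr0 mulr0 addr0 subr0.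
rewrite !ffunE !nbracket_edgeE /= val_edge_swap /= !ffunE /= !eps_s !sK.
(* For each choice of signs at the endpoints u and v, a polynomial identity remains in the
   coordinates of [x] and [y] at u, s u, v and s v. *)
by case: (eps _); case: (eps _); rewrite /= ?expr0 ?expr1; ring.
Qed.

Lemma rotation_adapted : admits_adapted_complex_structure R G.
Proof.
exists rotation; split; first by split; [exact: rotationK |
  exact: rotation_integrable].
move=> a; rewrite /= rotation_bvec.
case: (basis_sign a); [right | left]; exists (basis_swap a).
  by rewrite expr1 scaleN1r opprK.
by rewrite expr0 scale1r.
Qed.

End FirstEndpointRotation.

(** The enumeration of a sum type is the image of the left summand followed by that of the right
    one. *)
Lemma enum_rank_inl_inr (S T : finType) (x : S) (y : T) :
  (enum_rank (inl x : S + T) < enum_rank (inr y : S + T))%N.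
Proof.
have rankE (z : S + T) : nat_of_ord (enum_rank z) = index z (enum {: S + T}).
  by rewrite -[in RHS](nth_enum_rank z z) index_uniq ?enum_uniq // -cardE.
rewrite !rankE enumT unlock /= /sum_enum !index_cat.
(* [inl x] is found in the first block; [inr y] is not, so its index is shifted by the length of
   that block. *)
rewrite map_f ?mem_enum // ifN; last by apply/mapP => -[].
by apply: ltn_addr; rewrite index_mem map_f ?mem_enum.
Qed.

(** With the left part enumerated first, being an edge depends only on the parts of the two
    endpoints, so a map that preserves the parts satisfies [edge_s]. *)
Lemma is_edge_complete_bipartite p q (e : complete_bipartite p q *
    complete_bipartite p q) :
  is_edge e = match e with (inl _, inr _) => true | _ => false end.
Proof.
case: e => [[i|j] [i'|j']]; rewrite /is_edge /= ?andbF ?andbT //.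
  exact: enum_rank_inl_inr.
by apply/negbTE; rewrite -leqNgt ltnW ?enum_rank_inl_inr.
Qed.

(** The evenness of the part sizes enters here: an even index below 2k is at most 2k - 2, so its
    successor is still in range. *)
Lemma partner_proof k (i : 'I_(2 * k)) :
  ((if odd i then i.-1 else i.+1) < 2 * k)%N.
Proof. by have := ltn_ord i; case: ifP; lia. Qed.

Definition partner k (i : 'I_(2 * k)) : 'I_(2 * k) := Ordinal (partner_proof i).

Lemma odd_partner k (i : 'I_(2 * k)) : odd (partner i) = ~~ odd i.
Proof. by rewrite /=; case: ifP => /=; lia. Qed.

Lemma partnerK k : involutive (@partner k).
Proof.
move=> i; apply: val_inj; rewrite /=.
by case: (boolP (odd i)) => /= oi; case: ifP; lia.
Qed.

Theorem proposition3p5 (R : realType) (n m : nat) (hn : (0 < n)%N) (hm : (0 < m)%N) :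
  admits_adapted_complex_structure R (complete_bipartite (2 * n)%N (2 * m)%N).
Proof.
pose s (u : complete_bipartite (2 * n) (2 * m)) :
    complete_bipartite (2 * n) (2 * m) :=
  match u with inl i => inl (partner i) | inr j => inr (partner j) end.
(* In each pair the even vertex is sent to the odd one, and the odd vertex to minus the even one. *)
pose eps (u : complete_bipartite (2 * n) (2 * m)) :=
  match u with inl i => odd i | inr j => odd j end.
apply: (@rotation_adapted R _ s eps).
- by case=> i /=; rewrite partnerK.
- by case=> i; apply: odd_partner.
- by case=> [i|j] [i'|j']; rewrite !is_edge_complete_bipartite.
Qed.
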